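(* Let $0<\mathrm{Ste}<1$ and $\alpha\ge 0$. The unique solution $(T_{3h},s_{3h})$ to problem $(\mathrm{P}_{3h})$ converges to the unique solution $(T_3,s_3)$ to problem $(\mathrm{P}_3)$ when the heat transfer coefficient $h$ goes to infinity (all other parameters being fixed); that is, as $h\to\infty$, $s_{3h}(t)\to s_3(t)$ for every $t>0$, and $T_{3h}(x,t)\to T_3(x,t)$ for every $t>0$ and $0<x<s_3(t)$.
   Context: Fix real parameters $k,\rho,c,\gamma,\theta_\infty>0$ and $\alpha\ge 0$; put $a=\sqrt{k/(\rho c)}$ and $\mathrm{Ste}=\dfrac{k\theta_\infty}{\gamma a^{\alpha+2}}$. For $h>0$ put $\mathrm{Bi}=\dfrac{ah}{k}$. A candidate pair $(T,s)$ consists of a continuous function $s:[0,\infty)\to[0,\infty)$, positive and continuously differentiable on $(0,\infty)$, and a function $$T(x,t)=t^{\alpha/2}\theta_\infty\left[A\left(1-\frac{x}{s(t)}\right)+B\left(1-\frac{x}{s(t)}\right)^2\right],\quad 0\le x\le s(t),\ t>0,$$ with real constants $A,B$. Problem $(\mathrm{P}_{3h})$: find a candidate pair such that, for all $t>0$: (i) $\int_0^{s(t)}\int_0^x\frac{\partial T}{\partial t}(z,t)\,dz\,dx=-a^2\left[T(0,t)+\frac{\partial T}{\partial x}(0,t)s(t)\right]$; (ii) $k\frac{\partial T}{\partial x}(0,t)=\frac{h}{\sqrt t}\left[T(0,t)-\theta_\infty t^{\alpha/2}\right]$; (iii) $T(s(t),t)=0$; (iv) $k\frac{\partial T}{\partial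 x}(s(t),t)=-\gamma s(t)^{\alpha}\dot s(t)$; and (v) $s(0)=0$. Problem $(\mathrm{P}_3)$: the same with (ii) replaced by $T(0,t)=\theta_\infty t^{\alpha/2}$. The unique solution of $(\mathrm{P}_{3h})$ is the candidate pair with $s_{3h}(t)=2a\nu_{3h}\sqrt t$ and constants $$A_{3h}=\frac{12\nu_{3h}\left(1-\nu_{3h}^2\left(\frac{\alpha}{2}+\frac13\right)\right)}{2\alpha\nu_{3h}^3+\left(\frac{5\alpha+2}{\mathrm{Bi}}\right)\nu_{3h}^2+\frac{6}{\mathrm{Bi}}+12\nu_{3h}},\quad B_{3h}=\frac{12\nu_{3h}^3\left(\frac23\alpha+\frac13\right)}{2\alpha\nu_{3h}^3+\left(\frac{5\alpha+2}{\mathrm{Bi}}\right)\nu_{3h}^2+\frac{6}{\mathrm{Bi}}+12\nu_{3h}},$$ where $\nu_{3h}$ is the unique positive root of $2^{\alpha+1}\alpha z^{\alpha+4}+\frac{2^{\alpha}(2+5\alpha)}{\mathrm{Bi}}z^{\alpha+3}+3\cdot 2^{\alpha+2}z^{\alpha+2}+\frac{3\cdot 2^{\alpha+1}}{\mathrm{Bi}}z^{\alpha+1}+\mathrm{Ste}(2+3\alpha)z^2-6\,\mathrm{Ste}=0$. The unique solution of $(\mathrm{P}_3)$ is the candidate pair with $s_3(t)=2a\nu_3\sqrt t$ and constants $$A_3=\frac{6-(3\alpha+2)\nu_3^2}{\alpha\nu_3^2+6},\qquad B_3=\frac{(4\alpha+2)\nu_3^2}{\alpha\nu_3^2+6},$$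 where $\nu_3$ is the unique positive root of $2^{\alpha+1}\alpha z^{\alpha+4}+3\cdot 2^{\alpha+2}z^{\alpha+2}+\mathrm{Ste}(2+3\alpha)z^2-6\,\mathrm{Ste}=0$. In the convergence of $T_{3h}(x,t)$, for fixed $(x,t)$ one considers $h$ large enough that $x<s_{3h}(t)$. *)

(* Defs.v *)
From Stdlib Require Export Reals.
From Coquelicot Require Export Coquelicot.
Open Scope R_scope.

(* The data of a candidate pair (T, s): the constants A, B, which determine T
   once s is known, and the free boundary s, of which only the values on
   [0, +oo) matter. *)
Record candidate := Candidate {
  coefA : R;
  coefB : R;
  front : R -> R
}.

(* T(x,t).  The formula is kept outside 0 <= x <= s(t) as well: the two-sided
   partial derivatives at x = 0 and x = s(t) then agree with the one-sided ones
   taken from inside the domain.  It is meaningful for t > 0 only, since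
   [Rpower t _] is the real power just for t > 0. *)
Definition temperature (alpha theta_inf : R) (u : candidate) (x t : R) : R :=
  Rpower t (alpha / 2) * theta_inf *
  (coefA u * (1 - x / front u t) + coefB u * (1 - x / front u t) ^ 2).

Definition dT_dx (alpha theta_inf : R) (u : candidate) (x t : R) : R :=
  Derive (fun y => temperature alpha theta_inf u y t) x.

Definition dT_dt (alpha theta_inf : R) (u : candidate) (x t : R) : R :=
  Derive (fun tau => temperature alpha theta_inf u x tau) t.

Definition admissible (u : candidate) : Prop :=
  (forall t, 0 <= t -> 0 <= front u t) /\
  continuous_on (fun t => 0 <= t) (front u) /\
  (forall t, 0 < t ->
     0 < front u t /\ ex_derive (front u) t /\ continuous (Derive (front u)) t).

Definition sqrt_diffusivity (k rho c : R) : R := sqrt (k / (rho * c)).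

Definition Ste (k rho c gamma theta_inf alpha : R) : R :=
  k * theta_inf / (gamma * Rpower (sqrt_diffusivity k rho c) (alpha + 2)).

(* For an admissible candidate and t > 0 all the derivatives below exist and
   both integrands are continuous, so that the total operators [Derive] and
   [RInt] take their intended values. *)
Definition heat_balance (k rho c alpha theta_inf : R) (u : candidate) (t : R)
  : Prop :=
  RInt (fun x => RInt (fun z => dT_dt alpha theta_inf u z t) 0 x) 0 (front u t)
  = - (sqrt_diffusivity k rho c) ^ 2 *
    (temperature alpha theta_inf u 0 t
     + dT_dx alpha theta_inf u 0 t * front u t).

Definition robin_condition (k alpha theta_inf h : R) (u : candidate) (t : R)
  : Prop :=
  k * dT_dx alpha theta_inf u 0 t
  = h / sqrt t
    * (temperature alpha theta_inf u 0 t - theta_inf * Rpower t (alpha / 2)).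

Definition dirichlet_condition (alpha theta_inf : R) (u : candidate) (t : R)
  : Prop :=
  temperature alpha theta_inf u 0 t = theta_inf * Rpower t (alpha / 2).

Definition front_temperature (alpha theta_inf : R) (u : candidate) (t : R)
  : Prop :=
  temperature alpha theta_inf u (front u t) t = 0.

Definition stefan_condition (k gamma alpha theta_inf : R) (u : candidate) (t : R)
  : Prop :=
  k * dT_dx alpha theta_inf u (front u t) t
  = - gamma * Rpower (front u t) alpha * Derive (front u) t.

Definition P3h (k rho c gamma theta_inf alpha h : R) (u : candidate) : Prop :=
  admissible u /\
  (forall t, 0 < t ->
     heat_balance k rho c alpha theta_inf u t /\
     robin_condition k alpha theta_inf h u t /\
     front_temperature alpha theta_inf u t /\
     stefan_condition k gamma alpha theta_inf u t) /\
  front u 0 = 0.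

Definition P3 (k rho c gamma theta_inf alpha : R) (u : candidate) : Prop :=
  admissible u /\
  (forall t, 0 < t ->
     heat_balance k rho c alpha theta_inf u t /\
     dirichlet_condition alpha theta_inf u t /\
     front_temperature alpha theta_inf u t /\
     stefan_condition k gamma alpha theta_inf u t) /\
  front u 0 = 0.

(* Equality of the pairs (T, s), each on its own domain of definition. *)
Definition same_pair (alpha theta_inf : R) (u v : candidate) : Prop :=
  (forall t, 0 <= t -> front u t = front v t) /\
  (forall t x, 0 < t -> 0 <= x <= front u t ->
     temperature alpha theta_inf u x t = temperature alpha theta_inf v x t).

Definition has_unique_solution (alpha theta_inf : R) (P : candidate -> Prop)
  : Prop :=
  exists u, P u /\ forall v, P v -> same_pair alpha theta_inf u v.

(* Main.v *)
(* The Stefan condition is an ordinary differential equation for s^(alpha+2)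
   which, with s(0) = 0, forces s(t) = 2 a nu sqrt t.  The remaining conditions
   then become algebraic and, after elimination of A and B, amount to
   F(beta, nu) = 0 for a function F that is strictly increasing in nu and affine
   increasing in beta, where beta = 1/Bi for the Robin condition and beta = 0 for
   the Dirichlet condition.  Monotonicity gives existence and uniqueness of the
   root, and its convergence as beta tends to 0; the temperature at a given point
   is a continuous function of the root. *)
Require Import Defs.
From Stdlib Require Import Reals Lra Psatz.
From Coquelicot Require Import Coquelicot.
Open Scope R_scope.

(** * Real powers *)

Lemma Rpower_gt_0 (x p : R) : 0 < Rpower x p.
Proof. apply exp_pos. Qed.

Lemma is_derive_Rpower (f : R -> R) (df p x : R) :
  0 < f x -> is_derive f x df ->
  is_derive (fun y => Rpower (f y) p) x (p * Rpower (f x) (p - 1) * df).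
Proof.
  intros Hf Hd.
  apply is_derive_ext with (f := fun y => (fun z => Rpower z p) (f y)); [easy|].
  evar_last.
  - apply (is_derive_comp (fun z => Rpower z p)).
    + apply is_derive_Reals, derivable_pt_lim_power, Hf.
    + exact Hd.
  - unfold scal; simpl; unfold mult; simpl; ring.
Qed.

Lemma Rpower_pred_mult (x p : R) : 0 < x -> Rpower x (p - 1) * x = Rpower x p.
Proof.
  intros Hx. rewrite <- (Rpower_1 x Hx) at 2.
  rewrite <- Rpower_plus. f_equal; ring.
Qed.

(** Turns estimates near 0 into linear ones, both for the sign of [front_fun] at a small argument
    and for the behaviour of the front at small times. *)
Lemma Rpower_le_id (x p : R) : 0 < x <= 1 -> 1 <= p -> Rpower x p <= x.
Proof.
  intros Hx Hp. rewrite <- (Rpower_pred_mult x p) by lra.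
  assert (Rpower x (p - 1) <= 1); [|nra].
  replace 1 with (Rpower 1 (p - 1)) at 2
    by (unfold Rpower; rewrite ln_1, Rmult_0_r; apply exp_0).
  apply Rle_Rpower_l; lra.
Qed.

Lemma Rpower_inj_l (x y p : R) :
  0 < p -> 0 < x -> 0 < y -> Rpower x p = Rpower y p -> x = y.
Proof.
  intros Hp Hx Hy E.
  destruct (Rtotal_order x y) as [L | [L | L]]; [| exact L |];
    [pose proof (Rlt_Rpower_l x y p Hp ltac:(lra))
    | pose proof (Rlt_Rpower_l y x p Hp ltac:(lra))]; lra.
Qed.

Lemma Rpower_sqrt_l (t p : R) : 0 < t -> Rpower (sqrt t) p = Rpower t (p / 2).
Proof.
  intros Ht. rewrite <- (Rpower_sqrt t Ht), Rpower_mult. f_equal; field.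
Qed.

(** * The transcendental equation *)

Definition q_fun (alpha nu : R) : R := 1 - nu ^ 2 * (alpha / 2 + 1 / 3).

(** One sixth of the common denominator of the closed forms of [A] and [B]. *)
Definition d_fun (alpha beta nu : R) : R :=
  beta * (1 + nu ^ 2 * (5 * alpha / 6 + 1 / 3)) + 2 * nu * (1 + nu ^ 2 * alpha / 6).

(* Here [beta] is 1/Bi in problem (P_3h) and 0 in problem (P_3); three
   times this function is the one whose root the paper takes. *)
Definition front_fun (ste alpha beta nu : R) : R :=
  Rpower (2 * nu) (alpha + 1) * d_fun alpha beta nu - 2 * ste * q_fun alpha nu.

Lemma d_fun_pos (alpha beta nu : R) :
  0 <= alpha -> 0 <= beta -> 0 < nu -> 0 < d_fun alpha beta nu.
Proof.
  intros Ha Hb Hn. unfold d_fun.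
  assert (0 <= nu ^ 2 * alpha) by (apply Rmult_le_pos; nra).
  assert (0 <= nu ^ 2) by nra.
  assert (0 <= beta * (1 + nu ^ 2 * (5 * alpha / 6 + 1 / 3)))
    by (apply Rmult_le_pos; lra).
  assert (0 < 2 * nu * (1 + nu ^ 2 * alpha / 6)) by (apply Rmult_lt_0_compat; lra).
  lra.
Qed.

Lemma d_fun_incr (alpha beta x y : R) :
  0 <= alpha -> 0 <= beta -> 0 < x < y -> d_fun alpha beta x < d_fun alpha beta y.
Proof.
  intros Ha Hb H. unfold d_fun.
  assert (x ^ 2 < y ^ 2) by nra.
  assert (0 <= (y ^ 2 - x ^ 2) * alpha) by (apply Rmult_le_pos; lra).
  assert (0 <= x ^ 2 * alpha) by (apply Rmult_le_pos; nra).
  assert (beta * (1 + x ^ 2 * (5 * alpha / 6 + 1 / 3))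
          <= beta * (1 + y ^ 2 * (5 * alpha / 6 + 1 / 3)))
    by (apply Rmult_le_compat_l; lra).
  assert (2 * x * (1 + x ^ 2 * alpha / 6) < 2 * y * (1 + y ^ 2 * alpha / 6)).
  { apply Rlt_le_trans with (2 * y * (1 + x ^ 2 * alpha / 6)).
    - apply Rmult_lt_compat_r; lra.
    - apply Rmult_le_compat_l; lra. }
  lra.
Qed.

(** The first term is a product of two positive increasing factors, and [q_fun] is decreasing.
    Strictness persists at [beta = 0] because [d_fun] keeps the summand [2 * nu]. *)
Lemma front_fun_incr (ste alpha beta x y : R) :
  0 < ste -> 0 <= alpha -> 0 <= beta -> 0 < x < y ->
  front_fun ste alpha beta x < front_fun ste alpha beta y.
Proof.
  intros Hs Ha Hb H. unfold front_fun.
  pose proof (d_fun_incr alpha beta x y Ha Hb H).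
  pose proof (d_fun_pos alpha beta x Ha Hb ltac:(lra)).
  pose proof (Rlt_Rpower_l (2 * x) (2 * y) (alpha + 1) ltac:(lra) ltac:(lra)).
  pose proof (Rpower_gt_0 (2 * x) (alpha + 1)).
  assert (Rpower (2 * x) (alpha + 1) * d_fun alpha beta x
          < Rpower (2 * y) (alpha + 1) * d_fun alpha beta y)
    by (apply Rmult_gt_0_lt_compat; lra).
  assert (q_fun alpha y < q_fun alpha x).
  { unfold q_fun. assert (x ^ 2 < y ^ 2) by nra.
    assert (0 < (y ^ 2 - x ^ 2) * (alpha / 2 + 1 / 3))
      by (apply Rmult_lt_0_compat; lra). lra. }
  nra.
Qed.

Lemma front_fun_inj (ste alpha beta x y : R) :
  0 < ste -> 0 <= alpha -> 0 <= beta -> 0 < x -> 0 < y ->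
  front_fun ste alpha beta x = front_fun ste alpha beta y -> x = y.
Proof.
  intros Hs Ha Hb Hx Hy E.
  destruct (Rtotal_order x y) as [L | [L | L]]; [| exact L |];
    [pose proof (front_fun_incr ste alpha beta x y Hs Ha Hb ltac:(lra))
    | pose proof (front_fun_incr ste alpha beta y x Hs Ha Hb ltac:(lra))]; lra.
Qed.

Lemma continuous_front_fun (ste alpha beta x : R) :
  0 < x -> continuous (front_fun ste alpha beta) x.
Proof.
  intros Hx. apply (ex_derive_continuous (front_fun ste alpha beta)).
  unfold front_fun, d_fun, q_fun, Rpower. auto_derive. lra.
Qed.

(** Intermediate values on [[e, 2]]: near 0 the constant [-2 * ste] dominates, while at 2 already
    [q_fun] is negative, so both terms are positive. *)
Lemma front_fun_root (ste alpha beta : R) :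
  0 < ste -> 0 <= alpha -> 0 <= beta ->
  exists nu, 0 < nu /\ front_fun ste alpha beta nu = 0.
Proof.
  intros Hs Ha Hb.
  set (m := alpha / 2 + 1 / 3).
  set (M := d_fun alpha beta 1).
  assert (0 < M) by (apply d_fun_pos; lra).
  assert (0 < m) by (unfold m; lra).
  assert (0 < ste * m) by (apply Rmult_lt_0_compat; lra).
  (* The value at [e] is at most [2 * (e * M + ste * m * e - ste)], which is negative since
     [e * den = ste]. The summand [2 * ste] supplies the strictness and gives [2 * e < 1], as the
     bound on the power requires. *)
  set (den := M + ste * m + 2 * ste).
  set (e := ste / den).
  assert (0 < den) by (unfold den; lra).
  assert (He : e * den = ste) by (unfold e; field; lra).
  assert (He0 : 0 < e) by (apply Rdiv_lt_0_compat; lra).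
  assert (He2 : e < 1 / 2) by (unfold den in He; nra).
  destruct (Ranalysis5.IVT_interv (front_fun ste alpha beta) e 2) as [z [Hz Ez]].
  - intros a Haz. apply continuity_pt_filterlim, continuous_front_fun. lra.
  - lra.
  - unfold front_fun.
    pose proof (Rpower_le_id (2 * e) (alpha + 1) ltac:(lra) ltac:(lra)).
    pose proof (d_fun_incr alpha beta e 1 Ha Hb ltac:(lra)).
    pose proof (d_fun_pos alpha beta e Ha Hb ltac:(lra)).
    fold M in H4.
    assert (Rpower (2 * e) (alpha + 1) * d_fun alpha beta e <= 2 * e * M).
    { apply Rmult_le_compat; try lra. apply Rlt_le, Rpower_gt_0. }
    unfold q_fun. fold m.
    assert (ste * m * e ^ 2 <= ste * m * e) by (apply Rmult_le_compat_l; nra).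
    assert (0 < e * ste) by nra.
    unfold den in He. nra.
  - unfold front_fun.
    pose proof (Rpower_gt_0 (2 * 2) (alpha + 1)).
    pose proof (d_fun_pos alpha beta 2 Ha Hb ltac:(lra)).
    assert (0 < Rpower (2 * 2) (alpha + 1) * d_fun alpha beta 2) by nra.
    assert (q_fun alpha 2 < 0) by (unfold q_fun; lra).
    nra.
  - exists z. split; [lra | exact Ez].
Qed.

(* The root for [h] tends to the root for [beta = 0]: it lies below it because
   [front_fun] increases with [beta], and above any smaller number eventually
   because [front_fun] is affine in [beta]. *)
Lemma front_fun_root_lim (ste alpha kappa nu0 : R) (nu : R -> R) :
  0 < ste -> 0 <= alpha -> 0 < kappa ->
  0 < nu0 -> front_fun ste alpha 0 nu0 = 0 ->
  (forall h, 0 < h -> 0 < nu h /\ front_fun ste alpha (kappa / h) (nu h) = 0) ->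
  is_lim nu p_infty nu0.
Proof.
  intros Hs Ha Hk Hn0 E0 Hnu. apply is_lim_spec. intros [eps Heps]; simpl.
  assert (Aff : forall b x, front_fun ste alpha b x
    = front_fun ste alpha 0 x
      + b * (Rpower (2 * x) (alpha + 1) * (1 + x ^ 2 * (5 * alpha / 6 + 1 / 3)))).
  { intros; unfold front_fun, d_fun; ring. }
  (* The cap [nu0 / 2] keeps the comparison point [x] positive, where monotonicity is available. *)
  set (e := Rmin eps (nu0 / 2)).
  assert (0 < e) by (apply Rmin_pos; lra).
  assert (e <= eps) by apply Rmin_l.
  assert (e <= nu0 / 2) by apply Rmin_r.
  set (x := nu0 - e). assert (0 < x < nu0) by (unfold x; lra).
  pose proof (front_fun_incr ste alpha 0 x nu0 Hs Ha (Rle_refl 0) H2) as Hneg.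
  rewrite E0 in Hneg.
  assert (Hc : forall y, 0 < Rpower (2 * y) (alpha + 1)
                             * (1 + y ^ 2 * (5 * alpha / 6 + 1 / 3))).
  { intros y. apply Rmult_lt_0_compat; [apply Rpower_gt_0|].
    assert (0 <= y ^ 2 * (5 * alpha / 6 + 1 / 3)) by (apply Rmult_le_pos; nra).
    lra. }
  set (Cx := Rpower (2 * x) (alpha + 1) * (1 + x ^ 2 * (5 * alpha / 6 + 1 / 3))).
  assert (HCx : 0 < Cx) by apply Hc.
  (* Beyond this threshold the contribution [kappa / h * Cx] is too small to make [front_fun]
     nonnegative at [x]. *)
  set (M := kappa * Cx / - front_fun ste alpha 0 x).
  assert (0 < M).
  { apply Rdiv_lt_0_compat; [apply Rmult_lt_0_compat|]; lra. }
  exists M. intros h Hh. destruct (Hnu h ltac:(lra)) as [Hp Hr].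
  assert (0 < kappa / h) by (apply Rdiv_lt_0_compat; lra).
  assert (U : nu h <= nu0).
  { destruct (Rle_or_lt (nu h) nu0) as [L | L]; [exact L|].
    pose proof (front_fun_incr ste alpha 0 nu0 (nu h) Hs Ha (Rle_refl 0) ltac:(lra)).
    rewrite Aff in Hr. pose proof (Hc (nu h)). nra. }
  assert (L : x < nu h).
  { destruct (Rlt_or_le x (nu h)) as [L | L]; [exact L|].
    assert (front_fun ste alpha (kappa / h) x < 0).
    { rewrite Aff. fold Cx.
      assert (M * - front_fun ste alpha 0 x = kappa * Cx) by (unfold M; field; lra).
      assert (kappa / h * Cx < - front_fun ste alpha 0 x); [|lra].
      apply Rmult_lt_reg_r with h; [lra|].
      replace (kappa / h * Cx * h) with (kappa * Cx) by (field; lra).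
      nra. }
    destruct L as [L | L].
    - pose proof (front_fun_incr ste alpha (kappa / h) (nu h) x Hs Ha ltac:(lra) ltac:(lra)).
      lra.
    - rewrite <- L in *. lra. }
  apply Rabs_def1; unfold x in *; lra.
Qed.

(** * Similarity solutions *)

(* For the front [2 a nu sqrt t], the last three conjuncts are the heat balance,
   the Stefan condition and the condition at the fixed face. *)
Definition similarity (ste alpha beta nu A B : R) : Prop :=
  0 < nu /\
  A * (nu ^ 2 * (2 * alpha + 1) / 3) = B * q_fun alpha nu /\
  Rpower (2 * nu) (alpha + 2) = 2 * ste * A /\
  beta * (A + 2 * B) = 2 * nu * (1 - A - B).

(** The heat balance fixes the ratio of [A] to [B], the condition at the fixed face then fixes their
    scale, and the Stefan condition becomes the root equation multiplied by [2 * nu]. *)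
Lemma similarity_of_root (ste alpha beta nu : R) :
  0 < ste -> 0 <= alpha -> 0 <= beta -> 0 < nu ->
  front_fun ste alpha beta nu = 0 ->
  similarity ste alpha beta nu
    (2 * nu * q_fun alpha nu / d_fun alpha beta nu)
    (2 * nu * (nu ^ 2 * (2 * alpha + 1) / 3) / d_fun alpha beta nu).
Proof.
  intros Hs Ha Hb Hn E.
  pose proof (d_fun_pos alpha beta nu Ha Hb Hn) as Hd.
  repeat split.
  - exact Hn.
  - field; lra.
  - rewrite <- Rpower_pred_mult by lra.
    replace (alpha + 2 - 1) with (alpha + 1) by ring.
    unfold front_fun in E.
    apply Rmult_eq_reg_r with (d_fun alpha beta nu); [|lra].
    replace (2 * ste * (2 * nu * q_fun alpha nu / d_fun alpha beta nu)
             * d_fun alpha beta nu) with (2 * nu * (2 * ste * q_fun alpha nu))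
      by (field; lra).
    replace (2 * ste * q_fun alpha nu)
      with (Rpower (2 * nu) (alpha + 1) * d_fun alpha beta nu) by lra.
    ring.
  - apply Rmult_eq_reg_r with (d_fun alpha beta nu); [|lra].
    field_simplify; [|lra|lra].
    unfold q_fun, d_fun. field.
Qed.

(** Here [A] is read off the Stefan condition and [B] off the heat balance, so that neither formula
    contains [beta]. *)
Lemma similarity_root (ste alpha beta nu A B : R) :
  0 < ste -> 0 <= alpha -> 0 <= beta -> similarity ste alpha beta nu A B ->
  front_fun ste alpha beta nu = 0 /\ 0 < q_fun alpha nu /\
  A = Rpower (2 * nu) (alpha + 2) / (2 * ste) /\
  B = A * (nu ^ 2 * (2 * alpha + 1) / 3) / q_fun alpha nu.
Proof.
  intros Hs Ha Hb (Hn & E1 & E2 & E3).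
  pose proof (d_fun_pos alpha beta nu Ha Hb Hn) as Hd.
  pose proof (Rpower_gt_0 (2 * nu) (alpha + 2)) as Hpos.
  assert (HA : 0 < A) by nra.
  assert (Hp : 0 < nu ^ 2 * (2 * alpha + 1) / 3).
  { assert (0 < nu ^ 2 * (2 * alpha + 1)) by (apply Rmult_lt_0_compat; nra). lra. }
  (* If [q_fun] vanished, the heat balance would equate the positive left side with 0. *)
  assert (Hq : q_fun alpha nu <> 0) by (intros Z; rewrite Z in E1; nra).
  assert (EB : B = A * (nu ^ 2 * (2 * alpha + 1) / 3) / q_fun alpha nu)
    by (rewrite E1; field; exact Hq).
  (* The face condition multiplied by [q_fun], with [B * q_fun] eliminated by the heat balance. It
     also yields the sign of [q_fun], all other factors being positive. *)
  assert (ED : A * d_fun alpha beta nu = 2 * nu * q_fun alpha nu).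
  { transitivity (q_fun alpha nu * (beta * (A + 2 * B) + 2 * nu * (A + B))).
    - transitivity (beta * (A * q_fun alpha nu + 2 * (B * q_fun alpha nu))
                    + 2 * nu * (A * q_fun alpha nu + B * q_fun alpha nu)); [|ring].
      rewrite <- E1. unfold d_fun, q_fun. field.
    - rewrite E3. ring. }
  repeat split.
  - unfold front_fun.
    rewrite <- Rpower_pred_mult in E2 by lra.
    replace (alpha + 2 - 1) with (alpha + 1) in E2 by ring.
    apply Rmult_eq_reg_r with (2 * nu); [|lra].
    rewrite Rmult_minus_distr_r, Rmult_0_l.
    replace (Rpower (2 * nu) (alpha + 1) * d_fun alpha beta nu * (2 * nu))
      with (2 * ste * (A * d_fun alpha beta nu)) by (rewrite <- Rmult_assoc, <- E2; ring).
    rewrite ED. ring.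
  - nra.
  - rewrite E2. field. lra.
  - exact EB.
Qed.

(** * Reduction of the boundary value problem *)

Lemma dT_dx_eq (alpha theta_inf : R) (u : candidate) (x t : R) :
  front u t <> 0 ->
  dT_dx alpha theta_inf u x t
  = - (Rpower t (alpha / 2) * theta_inf
       * (coefA u + 2 * coefB u * (1 - x / front u t)) / front u t).
Proof.
  intros Hs. apply is_derive_unique. unfold temperature.
  auto_derive; [easy|]. field. exact Hs.
Qed.

Lemma dT_dt_eq (alpha theta_inf : R) (u : candidate) (x t : R) :
  0 < t -> front u t <> 0 -> ex_derive (front u) t ->
  dT_dt alpha theta_inf u x t
  = Rpower t (alpha / 2) * theta_inf *
    (alpha / (2 * t)
       * (coefA u * (1 - x / front u t) + coefB u * (1 - x / front u t) ^ 2)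
     + Derive (front u) t * x / front u t ^ 2
       * (coefA u + 2 * coefB u * (1 - x / front u t))).
Proof.
  intros Ht Hs Hd. apply is_derive_unique. unfold temperature, Rpower.
  auto_derive; [repeat split; assumption|].
  rewrite (Derive_ext (fun x => front u x) (front u)) by easy.
  field. lra.
Qed.

Lemma RInt_quadratic (c0 c1 c2 x : R) :
  RInt (fun z => c0 + c1 * z + c2 * z ^ 2) 0 x
  = c0 * x + c1 * x ^ 2 / 2 + c2 * x ^ 3 / 3.
Proof.
  apply is_RInt_unique. evar_last.
  - apply (is_RInt_derive (fun z => c0 * z + c1 * z ^ 2 / 2 + c2 * z ^ 3 / 3)).
    + intros z _. auto_derive; [easy|]. field.
    + intros z _. apply (ex_derive_continuous (fun z => c0 + c1 * z + c2 * z ^ 2)).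
      auto_derive. easy.
  - unfold minus, plus, opp; simpl. field.
Qed.

(** At a fixed time [dT_dt] is a quadratic polynomial in the space variable, so this evaluates the
    double integral of the heat balance. *)
Lemma RInt_RInt_quadratic (f : R -> R) (c0 c1 c2 x : R) :
  (forall z, f z = c0 + c1 * z + c2 * z ^ 2) ->
  RInt (fun y => RInt f 0 y) 0 x
  = c0 * x ^ 2 / 2 + c1 * x ^ 3 / 6 + c2 * x ^ 4 / 12.
Proof.
  intros Hf. rewrite (RInt_ext _ (fun y => c0 * y + c1 * y ^ 2 / 2 + c2 * y ^ 3 / 3)).
  - apply is_RInt_unique. evar_last.
    + apply (is_RInt_derive
        (fun z => c0 * z ^ 2 / 2 + c1 * z ^ 3 / 6 + c2 * z ^ 4 / 12)).
      * intros z _. auto_derive; [easy|]. simpl. field.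
      * intros z _. apply (ex_derive_continuous
          (fun y => c0 * y + c1 * y ^ 2 / 2 + c2 * y ^ 3 / 3)).
        auto_derive. easy.
    + unfold minus, plus, opp; simpl. field.
  - intros y _. rewrite (RInt_ext _ (fun z => c0 + c1 * z + c2 * z ^ 2)).
    + apply RInt_quadratic.
    + intros z _. apply Hf.
Qed.

Lemma sqrt_diffusivity_pos (k rho c : R) :
  0 < k -> 0 < rho -> 0 < c -> 0 < sqrt_diffusivity k rho c.
Proof.
  intros. apply sqrt_lt_R0, Rdiv_lt_0_compat; [|apply Rmult_lt_0_compat]; assumption.
Qed.

(** Both sides carry the positive factor [P]. On the right, the [A] terms of the face temperature
    and of the gradient times the front cancel, leaving only [B]. *)
Lemma heat_balance_iff (k rho c alpha theta_inf : R) (u : candidate) (t : R) :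
  0 < theta_inf -> 0 < t -> 0 < front u t -> ex_derive (front u) t ->
  heat_balance k rho c alpha theta_inf u t <->
  alpha / (2 * t) * front u t ^ 2 * (coefA u / 3 + coefB u / 4)
  + front u t * Derive (front u) t * (coefA u + coefB u) / 6
  = sqrt_diffusivity k rho c ^ 2 * coefB u.
Proof.
  intros Hth Ht Hs Hd. unfold heat_balance.
  set (s := front u t). set (ds := Derive (front u) t).
  set (A := coefA u). set (B := coefB u). set (P := Rpower t (alpha / 2) * theta_inf).
  assert (HP : 0 < P) by (apply Rmult_lt_0_compat; [apply Rpower_gt_0 | exact Hth]).
  fold s in Hs.
  rewrite (RInt_RInt_quadratic (fun z => dT_dt alpha theta_inf u z t)
    (P * (alpha / (2 * t) * (A + B)))
    (P * (ds / s ^ 2 * (A + 2 * B) - alpha / (2 * t) * (A + 2 * B) / s))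
    (P * (alpha / (2 * t) * B / s ^ 2 - 2 * B * ds / s ^ 3))).
  2: { intros z. rewrite dT_dt_eq by (assumption || fold s; lra).
       fold s ds A B P. field. lra. }
  rewrite dT_dx_eq by (fold s; lra). unfold temperature. fold s A B P.
  set (a := sqrt_diffusivity k rho c).
  match goal with |- ?X = ?Y <-> ?Z = ?W =>
    assert (EX : X = P * Z) by (field; lra);
    assert (EY : Y = P * W) by (field; lra) end.
  rewrite EX, EY. split; intros E.
  - apply Rmult_eq_reg_l with P; lra.
  - now rewrite E.
Qed.

(** At the front the [B] term of the gradient vanishes. Multiplying by the front raises the exponent
    to [alpha + 1], so the right side is a constant multiple of the derivative of the front to the
    power [alpha + 2]. *)
Lemma stefan_condition_iff (k gamma alpha theta_inf : R) (u : candidate) (t : R) :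
  0 < front u t ->
  stefan_condition k gamma alpha theta_inf u t <->
  k * theta_inf * coefA u * Rpower t (alpha / 2)
  = gamma * Rpower (front u t) (alpha + 1) * Derive (front u) t.
Proof.
  intros Hs. unfold stefan_condition. rewrite dT_dx_eq by lra.
  rewrite <- (Rpower_pred_mult (front u t) (alpha + 1)) by exact Hs.
  replace (alpha + 1 - 1) with alpha by ring.
  set (s := front u t) in *. set (Q := Rpower s alpha). set (ds := Derive (front u) t).
  set (P := Rpower t (alpha / 2)).
  replace (k * - (P * theta_inf * (coefA u + 2 * coefB u * (1 - s / s)) / s))
    with (- (k * theta_inf * coefA u * P) / s) by (field; lra).
  split; intros E.
  - apply Rmult_eq_compat_r with (r := s) in E.
    replace (- (k * theta_inf * coefA u * P) / s * s)
      with (- (k * theta_inf * coefA u * P)) in E by (field; lra).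
    lra.
  - rewrite E. field. lra.
Qed.

Lemma robin_condition_iff (k alpha theta_inf h : R) (u : candidate) (t : R) :
  0 < theta_inf -> 0 < t -> 0 < front u t ->
  robin_condition k alpha theta_inf h u t <->
  k * (coefA u + 2 * coefB u) * sqrt t
  = h * (1 - coefA u - coefB u) * front u t.
Proof.
  intros Hth Ht Hs. unfold robin_condition. rewrite dT_dx_eq by lra.
  unfold temperature.
  set (s := front u t) in *. set (P := Rpower t (alpha / 2)).
  assert (HP : 0 < P) by apply Rpower_gt_0.
  pose proof (sqrt_lt_R0 t Ht) as Hr.
  assert (HPt : 0 < P * theta_inf) by (apply Rmult_lt_0_compat; assumption).
  assert (Hsr : 0 < s * sqrt t) by (apply Rmult_lt_0_compat; assumption).
  set (A := coefA u). set (B := coefB u).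
  match goal with |- ?X = ?Y <-> ?Z = ?W =>
    assert (EX : X = - (P * theta_inf / (s * sqrt t)) * Z) by (field; lra);
    assert (EY : Y = - (P * theta_inf / (s * sqrt t)) * W) by (field; lra) end.
  rewrite EX, EY.
  assert (0 < P * theta_inf / (s * sqrt t)) by (apply Rdiv_lt_0_compat; assumption).
  split; intros E.
  - apply Rmult_eq_reg_l in E; [exact E | lra].
  - now rewrite E.
Qed.

Lemma dirichlet_condition_iff (alpha theta_inf : R) (u : candidate) (t : R) :
  0 < theta_inf -> 0 < front u t ->
  dirichlet_condition alpha theta_inf u t <-> coefA u + coefB u = 1.
Proof.
  intros Hth Hs. unfold dirichlet_condition, temperature.
  set (P := Rpower t (alpha / 2)).
  assert (HP : 0 < P) by apply Rpower_gt_0.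
  assert (HPt : 0 < theta_inf * P) by (apply Rmult_lt_0_compat; assumption).
  replace (P * theta_inf * (coefA u * (1 - 0 / front u t)
           + coefB u * (1 - 0 / front u t) ^ 2))
    with (theta_inf * P * (coefA u + coefB u)) by (field; lra).
  split; intros E.
  - apply Rmult_eq_reg_l with (theta_inf * P); lra.
  - rewrite E. ring.
Qed.

Lemma front_temperature_true (alpha theta_inf : R) (u : candidate) (t : R) :
  0 < front u t -> front_temperature alpha theta_inf u t.
Proof. intros Hs. unfold front_temperature, temperature. field. lra. Qed.

(* The Stefan condition makes [gamma s^(alpha+2) - 2 k theta_inf A t^((alpha+2)/2)]
   constant on (0, +oo), and [s(0) = 0] makes the constant vanish. *)
Lemma stefan_front_power (k gamma alpha theta_inf : R) (u : candidate) :
  0 < gamma -> 0 <= alpha -> admissible u -> front u 0 = 0 ->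
  (forall t, 0 < t -> stefan_condition k gamma alpha theta_inf u t) ->
  forall t, 0 < t ->
  gamma * Rpower (front u t) (alpha + 2)
  = 2 * k * theta_inf * coefA u * Rpower t (alpha / 2 + 1).
Proof.
  intros Hg Ha (Hnn & Hcont & Hpos) H0 Hst.
  set (K := 2 * k * theta_inf * coefA u).
  set (f := fun t => gamma * Rpower (front u t) (alpha + 2) - K * Rpower t (alpha / 2 + 1)).
  assert (Hf : forall t, 0 < t -> is_derive f t 0).
  { intros t Ht. destruct (Hpos t Ht) as (Hs & Hd & _).
    pose proof (proj1 (stefan_condition_iff _ _ _ _ _ _ Hs) (Hst t Ht)) as E.
    unfold f. evar_last.
    - apply (is_derive_minus (fun t => gamma * Rpower (front u t) (alpha + 2))
        (fun t => K * Rpower t (alpha / 2 + 1))).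
      + apply (is_derive_scal (fun t => Rpower (front u t) (alpha + 2))).
        apply is_derive_Rpower; [exact Hs | apply Derive_correct, Hd].
      + apply (is_derive_scal (fun t => Rpower t (alpha / 2 + 1))).
        apply (is_derive_Rpower (fun t => t)); [exact Ht | apply (is_derive_id t)].
    - unfold minus, plus, opp, one; simpl.
      replace (alpha + 2 - 1) with (alpha + 1) by ring.
      replace (alpha / 2 + 1 - 1) with (alpha / 2) by ring.
      (* The derivative of [f] is [alpha + 2] times the difference of the two sides of the rewritten
         Stefan condition. *)
      transitivity ((alpha + 2) *
        (gamma * Rpower (front u t) (alpha + 1) * Derive (front u) t
         - k * theta_inf * coefA u * Rpower t (alpha / 2))).
      + unfold K. field.
      + rewrite E. ring. }
  assert (Hconst : forall x y, 0 < x < y -> f x = f y).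
  { intros x y H. apply (eq_is_derive f x y); [|lra].
    intros t Ht. apply Hf. lra. }
  intros t Ht.
  enough (f t = 0) by (unfold f in *; lra).
  destruct (Req_dec (f t) 0) as [Z | NZ]; [exact Z | exfalso].
  assert (Hft : 0 < Rabs (f t)) by now apply Rabs_pos_lt.
  pose proof (Rabs_pos K) as HK.
  (* At a time where both the front and the time are at most [e], the absolute value of [f] is at
     most [(gamma + Rabs K) * e], which is less than [Rabs (f t)]. The last summand forces [e < 1],
     so that powers are bounded by their base. *)
  set (den := gamma + Rabs K + Rabs (f t)).
  assert (Hden : 0 < den) by (unfold den; lra).
  set (e := Rabs (f t) / (2 * den)).
  assert (He0 : 0 < e) by (apply Rdiv_lt_0_compat; lra).
  assert (He : 2 * e * den = Rabs (f t)) by (unfold e; field; lra).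
  assert (He1 : e < 1) by (unfold den in *; nra).
  destruct (proj1 (filterlim_locally _ _) (Hcont 0 (Rle_refl 0)) (mkposreal e He0))
    as [d Hd].
  pose proof (cond_pos d) as Hdpos.
  (* The three bounds give [x < t] for constancy of [f], closeness to 0 for continuity of the front,
     and [x <= e] for the power of time. *)
  set (x := Rmin (Rmin (t / 2) (d / 2)) e).
  assert (Hx0 : 0 < x) by (repeat apply Rmin_pos; lra).
  assert (Hx1 : x <= e) by apply Rmin_r.
  assert (Hx2 : x <= t / 2) by (eapply Rle_trans; [apply Rmin_l | apply Rmin_l]).
  assert (Hx3 : x <= d / 2) by (eapply Rle_trans; [apply Rmin_l | apply Rmin_r]).
  assert (Hball : ball (front u 0) e (front u x)).
  { apply Hd; [|lra].
    unfold ball; simpl; unfold AbsRing_ball, abs, minus, plus, opp; simpl.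
    apply Rabs_def1; lra. }
  unfold ball in Hball; simpl in Hball;
    unfold AbsRing_ball, abs, minus, plus, opp in Hball; simpl in Hball.
  rewrite H0 in Hball. apply Rabs_def2 in Hball.
  destruct (Hpos x Hx0) as (Hs & _).
  pose proof (Rpower_le_id (front u x) (alpha + 2) ltac:(lra) ltac:(lra)) as L1.
  pose proof (Rpower_le_id x (alpha / 2 + 1) ltac:(lra) ltac:(lra)) as L2.
  assert (E : f x = f t) by (apply Hconst; lra).
  assert (Rabs (f t) <= gamma * e + Rabs K * e).
  { rewrite <- E. unfold f. eapply Rle_trans; [apply Rabs_triang|].
    rewrite Rabs_Ropp, !Rabs_mult.
    rewrite !(Rabs_pos_eq (Rpower _ _)) by (apply Rlt_le, Rpower_gt_0).
    rewrite (Rabs_pos_eq gamma) by lra.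
    apply Rplus_le_compat; apply Rmult_le_compat_l; lra. }
  unfold den in He. nra.
Qed.

(** Comparing the power law at [t] with the one at 1 cancels the constant, and injectivity of the
    power gives the front itself. *)
Lemma stefan_front_sqrt (k gamma alpha theta_inf : R) (u : candidate) :
  0 < gamma -> 0 <= alpha -> admissible u -> front u 0 = 0 ->
  (forall t, 0 < t -> stefan_condition k gamma alpha theta_inf u t) ->
  forall t, 0 <= t -> front u t = front u 1 * sqrt t.
Proof.
  intros Hg Ha Hu H0 Hst t [Ht | <-]; [|rewrite sqrt_0, H0; ring].
  pose proof (stefan_front_power _ _ _ _ _ Hg Ha Hu H0 Hst) as Hpw.
  destruct Hu as (_ & _ & Hpos).
  destruct (Hpos t Ht) as (Hs & _). destruct (Hpos 1 Rlt_0_1) as (Hs1 & _).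
  pose proof (sqrt_lt_R0 t Ht) as Hr.
  apply (Rpower_inj_l _ _ (alpha + 2)); [lra | exact Hs | nra |].
  rewrite <- Rpower_mult_distr by assumption.
  rewrite Rpower_sqrt_l by exact Ht.
  replace ((alpha + 2) / 2) with (alpha / 2 + 1) by field.
  apply Rmult_eq_reg_l with gamma; [|lra].
  rewrite <- Rmult_assoc, (Hpw t Ht), (Hpw 1 Rlt_0_1).
  unfold Rpower at 2. rewrite ln_1, Rmult_0_r, exp_0. ring.
Qed.

(** * The conditions along a square-root front *)

Lemma is_derive_sqrt_front (b : R) (s : R -> R) (t : R) :
  0 < t -> (forall x, 0 <= x -> s x = b * sqrt x) ->
  is_derive s t (b / (2 * sqrt t)).
Proof.
  intros Ht Hs. apply is_derive_ext_loc with (f := fun x => b * sqrt x).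
  (* The formula for [s] is given at nonnegative times only; the ball of radius [t] around [t] stays
     among them. *)
  - exists (mkposreal t Ht). intros x Hx. symmetry. apply Hs.
    unfold ball in Hx; simpl in Hx;
      unfold AbsRing_ball, abs, minus, plus, opp in Hx; simpl in Hx.
    apply Rabs_def2 in Hx. lra.
  - pose proof (sqrt_lt_R0 t Ht). auto_derive; [exact Ht|]. field. lra.
Qed.

(** Along this front, the squared front over [t] and the front times its speed are constant, so [t]
    drops out and the factor [a ^ 2] can be divided away. *)
Lemma heat_balance_similarity (k rho c alpha theta_inf nu : R) (u : candidate) (t : R) :
  0 < k -> 0 < rho -> 0 < c -> 0 < theta_inf -> 0 < nu -> 0 < t ->
  (forall x, 0 <= x -> front u x = 2 * sqrt_diffusivity k rho c * nu * sqrt x) ->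
  heat_balance k rho c alpha theta_inf u t <->
  coefA u * (nu ^ 2 * (2 * alpha + 1) / 3) = coefB u * q_fun alpha nu.
Proof.
  intros Hk Hr Hc Hth Hn Ht Hfr.
  pose proof (sqrt_diffusivity_pos k rho c Hk Hr Hc) as Ha.
  set (a := sqrt_diffusivity k rho c) in *.
  pose proof (sqrt_lt_R0 t Ht) as Hst.
  pose proof (is_derive_sqrt_front _ _ t Ht Hfr) as Hd.
  assert (Hs : 0 < front u t).
  { rewrite Hfr by lra. repeat apply Rmult_lt_0_compat; lra. }
  rewrite heat_balance_iff; [|assumption..|eexists; exact Hd].
  rewrite (is_derive_unique _ _ _ Hd), Hfr by lra. fold a.
  assert (Esq : t = sqrt t * sqrt t) by (symmetry; apply sqrt_sqrt; lra).
  match goal with |- ?X = ?Y <-> ?Z = ?W =>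
    assert (E : X - Y = a ^ 2 * (Z - W)) end.
  { rewrite Esq at 1. unfold q_fun. field. lra. }
  assert (0 < a ^ 2) by nra. split; intros; nra.
Qed.

Lemma stefan_condition_similarity (k rho c gamma alpha theta_inf nu : R)
    (u : candidate) (t : R) :
  0 < k -> 0 < rho -> 0 < c -> 0 < gamma -> 0 < nu -> 0 < t ->
  (forall x, 0 <= x -> front u x = 2 * sqrt_diffusivity k rho c * nu * sqrt x) ->
  stefan_condition k gamma alpha theta_inf u t <->
  Rpower (2 * nu) (alpha + 2) = 2 * Ste k rho c gamma theta_inf alpha * coefA u.
Proof.
  intros Hk Hr Hc Hg Hn Ht Hfr.
  pose proof (sqrt_diffusivity_pos k rho c Hk Hr Hc) as Ha.
  unfold Ste.
  set (a := sqrt_diffusivity k rho c) in *.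
  pose proof (sqrt_lt_R0 t Ht) as Hst.
  pose proof (is_derive_sqrt_front _ _ t Ht Hfr) as Hd.
  assert (Hs : 0 < front u t).
  { rewrite Hfr by lra. repeat apply Rmult_lt_0_compat; lra. }
  rewrite stefan_condition_iff by exact Hs.
  rewrite (is_derive_unique _ _ _ Hd), Hfr by lra.
  replace (2 * a * nu * sqrt t) with (a * (2 * nu) * sqrt t) by ring.
  replace (alpha + 1) with (alpha + 2 - 1) by ring.
  (* The front speed supplies one more factor [a * (2 * nu)] and removes one [sqrt t]; the resulting
     power of [a] is the one in [Ste]. *)
  assert (Epow : gamma * Rpower (a * (2 * nu) * sqrt t) (alpha + 2 - 1)
                 * (2 * a * nu / (2 * sqrt t))
                 = gamma / 2 * (Rpower a (alpha + 2) * Rpower (2 * nu) (alpha + 2))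
                   * Rpower t (alpha / 2)).
  { rewrite Rpower_mult_distr by lra.
    rewrite <- (Rpower_pred_mult (a * (2 * nu)) (alpha + 2)) by nra.
    rewrite <- (Rpower_mult_distr (a * (2 * nu)) (sqrt t)) by nra.
    replace (Rpower t (alpha / 2)) with (Rpower (sqrt t) alpha)
      by (apply Rpower_sqrt_l; exact Ht).
    replace (alpha + 2 - 1) with (alpha + 1) by ring.
    rewrite <- (Rpower_pred_mult (sqrt t) (alpha + 1)) by exact Hst.
    replace (alpha + 1 - 1) with alpha by ring.
    field. lra. }
  rewrite Epow.
  pose proof (Rpower_gt_0 a (alpha + 2)) as Hap.
  pose proof (Rpower_gt_0 t (alpha / 2)) as Htp.
  set (U := Rpower a (alpha + 2)) in *. set (V := Rpower t (alpha / 2)) in *.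
  set (W := Rpower (2 * nu) (alpha + 2)).
  assert (HgU : 0 < gamma * U) by (apply Rmult_lt_0_compat; assumption).
  split; intros E.
  - apply Rmult_eq_reg_r in E; [|lra].
    apply Rmult_eq_reg_l with (gamma * U / 2); [|lra].
    replace (gamma * U / 2 * (2 * (k * theta_inf / (gamma * U)) * coefA u))
      with (k * theta_inf * coefA u) by (field; lra).
    rewrite E. field.
  - rewrite E. field. lra.
Qed.

(** The coefficient [k / sqrt_diffusivity k rho c / h] is 1/Bi, the value of [beta] for the Robin
    condition. *)
Lemma robin_condition_similarity (k rho c alpha theta_inf h nu : R)
    (u : candidate) (t : R) :
  0 < k -> 0 < rho -> 0 < c -> 0 < theta_inf -> 0 < h -> 0 < nu -> 0 < t ->
  (forall x, 0 <= x -> front u x = 2 * sqrt_diffusivity k rho c * nu * sqrt x) ->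
  robin_condition k alpha theta_inf h u t <->
  k / sqrt_diffusivity k rho c / h * (coefA u + 2 * coefB u)
  = 2 * nu * (1 - coefA u - coefB u).
Proof.
  intros Hk Hr Hc Hth Hh Hn Ht Hfr.
  pose proof (sqrt_diffusivity_pos k rho c Hk Hr Hc) as Ha.
  set (a := sqrt_diffusivity k rho c) in *.
  pose proof (sqrt_lt_R0 t Ht) as Hst.
  assert (Hs : 0 < front u t).
  { rewrite Hfr by lra. repeat apply Rmult_lt_0_compat; lra. }
  rewrite robin_condition_iff by assumption. rewrite Hfr by lra.
  assert (Hc0 : 0 < h * a * sqrt t) by (repeat apply Rmult_lt_0_compat; lra).
  match goal with |- ?X = ?Y <-> ?Z = ?W =>
    assert (EX : X = (h * a * sqrt t) * Z) by (field; lra);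
    assert (EY : Y = (h * a * sqrt t) * W) by ring end.
  rewrite EX, EY. split; intros E.
  - apply Rmult_eq_reg_l in E; [exact E | lra].
  - now rewrite E.
Qed.

Lemma admissible_sqrt_front (A B b : R) :
  0 < b -> admissible (Candidate A B (fun t => b * sqrt t)).
Proof.
  intros Hb. repeat split; simpl.
  - intros t _. pose proof (sqrt_pos t). nra.
  - apply continuous_on_forall. intros t _.
    apply (continuous_mult (fun _ => b) sqrt);
      [apply continuous_const | apply continuous_sqrt].
  - apply Rmult_lt_0_compat; [exact Hb | now apply sqrt_lt_R0].
  - eexists. apply (is_derive_sqrt_front b); easy.
  - apply continuous_ext_loc with (g := fun t => b / (2 * sqrt t)).
    + exists (mkposreal t H). intros x Hx. symmetry. apply is_derive_unique.
      apply (is_derive_sqrt_front b); [|easy].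
      unfold ball in Hx; simpl in Hx;
        unfold AbsRing_ball, abs, minus, plus, opp in Hx; simpl in Hx.
      apply Rabs_def2 in Hx. lra.
    + pose proof (sqrt_lt_R0 t H).
      apply (ex_derive_continuous (fun t => b / (2 * sqrt t))).
      auto_derive. repeat split; lra.
Qed.

(** * Both problems as one algebraic system with parameter [beta] *)

Definition similarity_solution (a ste alpha beta : R) (u : candidate) : Prop :=
  exists nu, (forall t, 0 <= t -> front u t = 2 * a * nu * sqrt t) /\
    similarity ste alpha beta nu (coefA u) (coefB u).

(* Problems (P_3h) and (P_3) with their condition at the fixed face abstracted
   to [bc]. *)
Definition stefan_problem (k rho c gamma theta_inf alpha : R)
    (bc : candidate -> R -> Prop) (u : candidate) : Prop :=
  admissible u /\
  (forall t, 0 < t ->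
     heat_balance k rho c alpha theta_inf u t /\
     bc u t /\
     front_temperature alpha theta_inf u t /\
     stefan_condition k gamma alpha theta_inf u t) /\
  front u 0 = 0.

(** The interface through which either face condition enters. The forward implication serves
    uniqueness, the backward one existence. *)
Definition bc_similarity (a beta : R) (bc : candidate -> R -> Prop) : Prop :=
  forall u nu t, 0 < nu -> 0 < t ->
    (forall x, 0 <= x -> front u x = 2 * a * nu * sqrt x) ->
    bc u t <-> beta * (coefA u + 2 * coefB u) = 2 * nu * (1 - coefA u - coefB u).

(** Once the front is a multiple of [sqrt t], the conditions are equivalent to time-independent
    equations, so reading them at time 1 suffices. *)
Lemma stefan_problem_similarity (k rho c gamma theta_inf alpha beta : R)
    (bc : candidate -> R -> Prop) (u : candidate) :
  0 < k -> 0 < rho -> 0 < c -> 0 < gamma -> 0 < theta_inf -> 0 <= alpha ->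
  bc_similarity (sqrt_diffusivity k rho c) beta bc ->
  stefan_problem k rho c gamma theta_inf alpha bc u ->
  similarity_solution (sqrt_diffusivity k rho c) (Ste k rho c gamma theta_inf alpha)
    alpha beta u.
Proof.
  intros Hk Hr Hc Hg Hth Hal Hbc (Hu & Heq & H0).
  pose proof (sqrt_diffusivity_pos k rho c Hk Hr Hc) as Ha.
  pose proof (stefan_front_sqrt k gamma alpha theta_inf u Hg Hal Hu H0
    (fun t Ht => proj2 (proj2 (proj2 (Heq t Ht))))) as Hfr.
  destruct (proj2 (proj2 Hu) 1 Rlt_0_1) as (Hs1 & _).
  destruct (Heq 1 Rlt_0_1) as (E1 & E2 & _ & E4).
  set (a := sqrt_diffusivity k rho c) in *.
  set (nu := front u 1 / (2 * a)).
  assert (Hfr' : forall t, 0 <= t -> front u t = 2 * a * nu * sqrt t).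
  { intros t Ht. rewrite Hfr by exact Ht. unfold nu. field. lra. }
  assert (Hnu : 0 < nu) by (apply Rdiv_lt_0_compat; lra).
  exists nu. split; [exact Hfr'|]. repeat split.
  - exact Hnu.
  - apply (heat_balance_similarity k rho c alpha theta_inf nu u 1); auto using Rlt_0_1.
  - apply (stefan_condition_similarity k rho c gamma alpha theta_inf nu u 1);
      auto using Rlt_0_1.
  - apply (Hbc u nu 1); auto using Rlt_0_1.
Qed.

Lemma similarity_stefan_problem (k rho c gamma theta_inf alpha beta nu A B : R)
    (bc : candidate -> R -> Prop) :
  0 < k -> 0 < rho -> 0 < c -> 0 < gamma -> 0 < theta_inf ->
  bc_similarity (sqrt_diffusivity k rho c) beta bc ->
  similarity (Ste k rho c gamma theta_inf alpha) alpha beta nu A B ->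
  stefan_problem k rho c gamma theta_inf alpha bc
    (Candidate A B (fun t => 2 * sqrt_diffusivity k rho c * nu * sqrt t)).
Proof.
  intros Hk Hr Hc Hg Hth Hbc (Hn & E1 & E2 & E3).
  pose proof (sqrt_diffusivity_pos k rho c Hk Hr Hc) as Ha.
  assert (Hb : 0 < 2 * sqrt_diffusivity k rho c * nu)
    by (repeat apply Rmult_lt_0_compat; lra).
  split; [now apply admissible_sqrt_front|].
  split; [|simpl; rewrite sqrt_0; ring].
  intros t Ht. repeat split.
  - now apply (heat_balance_similarity k rho c alpha theta_inf nu).
  - now apply (Hbc _ nu).
  - apply front_temperature_true; simpl.
    apply Rmult_lt_0_compat; [exact Hb | now apply sqrt_lt_R0].
  - now apply (stefan_condition_similarity k rho c gamma alpha theta_inf nu).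
Qed.

(** The temperature with [A] and [B] eliminated by [similarity_root]. Both problems share this
    function, and [h] acts on it through [nu] alone. *)
Definition similarity_temperature (a ste theta_inf alpha x t nu : R) : R :=
  Rpower t (alpha / 2) * theta_inf * (Rpower (2 * nu) (alpha + 2) / (2 * ste)) *
  (1 - x / (2 * a * nu * sqrt t)
   + nu ^ 2 * (2 * alpha + 1) / 3 / q_fun alpha nu
     * (1 - x / (2 * a * nu * sqrt t)) ^ 2).

(** Recovering [nu] from the front at time 1 makes it a function of the candidate, so a family of
    solutions gives [nu] as a function of [h] without any choice. *)
Lemma similarity_solution_eq (a ste theta_inf alpha beta : R) (u : candidate) :
  0 < a -> 0 < ste -> 0 <= alpha -> 0 <= beta ->
  similarity_solution a ste alpha beta u ->
  let nu := front u 1 / (2 * a) in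
  0 < nu /\ front_fun ste alpha beta nu = 0 /\ 0 < q_fun alpha nu /\
  (forall t, 0 <= t -> front u t = 2 * a * nu * sqrt t) /\
  (forall x t, 0 < t ->
     temperature alpha theta_inf u x t
     = similarity_temperature a ste theta_inf alpha x t nu).
Proof.
  intros Ha Hs Hal Hb (nu & Hfr & Hsim).
  assert (E : front u 1 / (2 * a) = nu).
  { rewrite Hfr by lra. rewrite sqrt_1. field. lra. }
  cbv zeta. rewrite E.
  destruct (similarity_root _ _ _ _ _ _ Hs Hal Hb Hsim) as (Hroot & Hq & EA & EB).
  destruct Hsim as (Hn & _).
  repeat split; try assumption.
  intros x t Ht. unfold temperature, similarity_temperature.
  rewrite EB, EA, Hfr by lra.
  pose proof (sqrt_lt_R0 t Ht). field. repeat split; lra.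
Qed.

Lemma continuous_similarity_temperature (a ste theta_inf alpha x t nu : R) :
  0 < a -> 0 < ste -> 0 < t -> 0 < nu -> q_fun alpha nu <> 0 ->
  continuous (similarity_temperature a ste theta_inf alpha x t) nu.
Proof.
  intros Ha Hs Ht Hn Hq.
  apply (ex_derive_continuous (similarity_temperature a ste theta_inf alpha x t)).
  pose proof (sqrt_lt_R0 t Ht) as Hr.
  assert (0 < 2 * a * nu * sqrt t) by (repeat apply Rmult_lt_0_compat; lra).
  unfold similarity_temperature, Rpower, q_fun in *. auto_derive.
  repeat split; try lra; intros Z; apply Hq; rewrite <- Z; field.
Qed.

(** * Uniqueness, existence and the limit of large [h] *)

Lemma similarity_solution_unique (a ste theta_inf alpha beta : R) (u v : candidate) :
  0 < a -> 0 < ste -> 0 <= alpha -> 0 <= beta ->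
  similarity_solution a ste alpha beta u -> similarity_solution a ste alpha beta v ->
  same_pair alpha theta_inf u v.
Proof.
  intros Ha Hs Hal Hb Hu Hv.
  destruct (similarity_solution_eq a ste theta_inf alpha beta u Ha Hs Hal Hb Hu)
    as (Hn & Er & _ & Ef & Et).
  destruct (similarity_solution_eq a ste theta_inf alpha beta v Ha Hs Hal Hb Hv)
    as (Hn' & Er' & _ & Ef' & Et').
  assert (E : front u 1 / (2 * a) = front v 1 / (2 * a)).
  { apply (front_fun_inj ste alpha beta); try assumption. congruence. }
  split.
  - intros t Ht. rewrite Ef, Ef', E by exact Ht. reflexivity.
  - intros t x Ht _. rewrite Et, Et', E by exact Ht. reflexivity.
Qed.

Lemma stefan_problem_unique_solution (k rho c gamma theta_inf alpha beta : R)
    (bc : candidate -> R -> Prop) :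
  0 < k -> 0 < rho -> 0 < c -> 0 < gamma -> 0 < theta_inf -> 0 <= alpha ->
  0 <= beta -> 0 < Ste k rho c gamma theta_inf alpha ->
  bc_similarity (sqrt_diffusivity k rho c) beta bc ->
  has_unique_solution alpha theta_inf
    (stefan_problem k rho c gamma theta_inf alpha bc).
Proof.
  intros Hk Hr Hc Hg Hth Hal Hb Hs Hbc.
  destruct (front_fun_root _ alpha beta Hs Hal Hb) as (nu & Hn & Hroot).
  pose proof (similarity_stefan_problem _ _ _ _ _ _ _ _ _ _ _ Hk Hr Hc Hg Hth Hbc
    (similarity_of_root _ _ _ _ Hs Hal Hb Hn Hroot)) as Hu.
  eexists. split; [exact Hu|]. intros v Hv.
  apply (similarity_solution_unique _ _ _ _ beta _ _
    (sqrt_diffusivity_pos _ _ _ Hk Hr Hc) Hs Hal Hb);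
    eapply stefan_problem_similarity; eassumption.
Qed.

(** At [beta = 0] the left side vanishes, and [2 * nu] cancels from the right. *)
Lemma dirichlet_bc_similarity (a alpha theta_inf : R) :
  0 < a -> 0 < theta_inf ->
  bc_similarity a 0 (dirichlet_condition alpha theta_inf).
Proof.
  intros Ha Hth u nu t Hn Ht Hfr.
  rewrite dirichlet_condition_iff; [|exact Hth|].
  - split; intros E; nra.
  - rewrite Hfr by lra. pose proof (sqrt_lt_R0 t Ht).
    repeat apply Rmult_lt_0_compat; lra.
Qed.

Lemma robin_bc_similarity (k rho c alpha theta_inf h : R) :
  0 < k -> 0 < rho -> 0 < c -> 0 < theta_inf -> 0 < h ->
  bc_similarity (sqrt_diffusivity k rho c) (k / sqrt_diffusivity k rho c / h)
    (robin_condition k alpha theta_inf h).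
Proof.
  intros Hk Hr Hc Hth Hh u nu t Hn Ht Hfr.
  now apply robin_condition_similarity.
Qed.

Theorem theorem4p5 (k rho c gamma theta_inf alpha : R)
  (hk : 0 < k) (hrho : 0 < rho) (hc : 0 < c) (hgamma : 0 < gamma)
  (htheta : 0 < theta_inf) (halpha : 0 <= alpha)
  (hSte : 0 < Ste k rho c gamma theta_inf alpha < 1) :
  (forall h, 0 < h ->
     has_unique_solution alpha theta_inf
       (P3h k rho c gamma theta_inf alpha h)) /\
  has_unique_solution alpha theta_inf (P3 k rho c gamma theta_inf alpha) /\
  (forall (u3h : R -> candidate) (u3 : candidate),
     (forall h, 0 < h -> P3h k rho c gamma theta_inf alpha h (u3h h)) ->
     P3 k rho c gamma theta_inf alpha u3 ->
     (forall t, 0 < t ->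
        is_lim (fun h => front (u3h h) t) p_infty (front u3 t)) /\
     (forall t x, 0 < t -> 0 < x < front u3 t ->
        is_lim (fun h => temperature alpha theta_inf (u3h h) x t) p_infty
               (temperature alpha theta_inf u3 x t))).
Proof.
  pose proof (sqrt_diffusivity_pos k rho c hk hrho hc) as Ha.
  pose proof (proj1 hSte) as Hs.
  assert (Hbeta : forall h, 0 < h -> 0 < k / sqrt_diffusivity k rho c / h).
  { intros h Hh. now repeat apply Rdiv_lt_0_compat. }
  assert (Hbc3 := dirichlet_bc_similarity _ alpha theta_inf Ha htheta).
  assert (Hbch := fun h => robin_bc_similarity k rho c alpha theta_inf h hk hrho hc htheta).
  split; [|split].
  - intros h Hh.
    (* [P3h] and [P3] are instances of [stefan_problem] up to unfolding. *)
    apply stefan_problem_unique_solution with (beta := k / sqrt_diffusivity k rho c / h);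
      auto using Rlt_le.
  - apply stefan_problem_unique_solution with (beta := 0); auto using Rle_refl.
  - intros u3h u3 H3h H3.
    destruct (similarity_solution_eq _ _ theta_inf _ _ u3 Ha Hs halpha (Rle_refl 0)
      (stefan_problem_similarity _ _ _ _ _ _ _ _ _ hk hrho hc hgamma htheta halpha
         Hbc3 H3)) as (Hn & Er & Hq & Ef & Et).
    assert (Hh := fun h (Hh : 0 < h) =>
      similarity_solution_eq _ _ theta_inf _ _ (u3h h) Ha Hs halpha
        (Rlt_le _ _ (Hbeta h Hh))
        (stefan_problem_similarity _ _ _ _ _ _ _ _ _ hk hrho hc hgamma htheta halpha
           (Hbch h Hh) (H3h h Hh))).
    set (a := sqrt_diffusivity k rho c) in *.
    set (ste := Ste k rho c gamma theta_inf alpha) in *.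
    set (nu0 := front u3 1 / (2 * a)) in *.
    set (nu := fun h => front (u3h h) 1 / (2 * a)).
    assert (Hlim : is_lim nu p_infty nu0).
    { apply (front_fun_root_lim ste alpha (k / a)); try assumption.
      - now apply Rdiv_lt_0_compat.
      - intros h H. destruct (Hh h H) as (H1 & H2 & _). now split. }
    split.
    + intros t Ht. rewrite Ef by lra.
      apply is_lim_ext_loc with (f := fun h => (fun y => 2 * a * y * sqrt t) (nu h)).
      (* The square-root law is known for positive [h] only, hence an equality near infinity. *)
      * exists 0. intros h H. destruct (Hh h H) as (_ & _ & _ & E & _).
        rewrite E by lra. reflexivity.
      * apply (is_lim_comp_continuous nu (fun y => 2 * a * y * sqrt t)); [exact Hlim|].
        apply (ex_derive_continuous (fun y => 2 * a * y * sqrt t)).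
        auto_derive. easy.
    + intros t x Ht _. rewrite Et by exact Ht.
      apply is_lim_ext_loc with
        (f := fun h => similarity_temperature a ste theta_inf alpha x t (nu h)).
      * exists 0. intros h H. destruct (Hh h H) as (_ & _ & _ & _ & E).
        rewrite E by exact Ht. reflexivity.
      * apply is_lim_comp_continuous; [exact Hlim|].
        (* Positivity of [q_fun] at the limiting root [nu0] keeps the denominator in the temperature
           from vanishing. *)
        apply continuous_similarity_temperature; try assumption. lra.
Qed.
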